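(* Let $k\ge 1$ be an integer, let $u_1,\ldots,u_m\neq 1$ ($m\ge1$) be $k$-bounded monomials in $S=K[x_1,\ldots,x_n]$, $K$ a field, and let $I=B_k(u_1,\ldots,u_m)$. Then $$\operatorname{height}(I)=\max\{\min(u_1),\ldots,\min(u_m)\}.$$
   Context: For a monomial $u$, $\operatorname{supp}(u)=\{i: x_i\mid u\}$ and $\min(u)=\min(\operatorname{supp}(u))$. A monomial $u=x_1^{a_1}\cdots x_n^{a_n}$ is $k$-bounded if $a_i\le k$ for all $i$; a monomial ideal is $k$-bounded if it is generated by $k$-bounded monomials. A $k$-bounded monomial ideal $I$ is $k$-Borel if for every $k$-bounded monomial $u\in I$, every $j\in\operatorname{supp}(u)$ and every $i<j$ one has $x_i(u/x_j)\in I$, provided $x_i(u/x_j)$ is $k$-bounded. $B_k(u_1,\ldots,u_m)$ denotes the unique smallest $k$-Borel ideal containing the $k$-bounded monomials $u_1,\ldots,u_m$ (the intersection of all $k$-Borel ideals containing them). *)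

(* Defs.v *)
From mathcomp Require Import all_boot all_order all_algebra.
From mathcomp Require Import boolp classical_sets.
From mathcomp Require Import freeg mpoly.

Set Implicit Arguments.
Unset Strict Implicit.
Unset Printing Implicit Defensive.

Import GRing.Theory.

Local Open Scope classical_set_scope.
Local Open Scope ring_scope.

Section Height.

Variable R : comNzRingType.
Implicit Types I P Q : set R.

(* The unit ideal is an ideal here, unlike for idealr_closed. *)
Definition is_ideal I : Prop :=
  [/\ I 0, forall x y, I x -> I y -> I (x + y) & forall a x, I x -> I (a * x)].

Definition ideal_generated (G : set R) : set R := smallest is_ideal G.

Definition is_prime P : Prop :=
  [/\ is_ideal P, ~ P 1 & forall x y, P (x * y) -> P x \/ P y].

(* A strictly increasing chain of primes C 0 < C 1 < ... < C h = P; such a chain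
   exists if and only if the height of P, possibly infinite, is at least h. *)
Definition prime_chain P (h : nat) : Prop :=
  exists C : nat -> set R,
    [/\ forall i, (i <= h)%N -> is_prime (C i),
        forall i, (i < h)%N -> C i `<` C i.+1 & C h = P].

Definition prime_height P (h : nat) : Prop :=
  prime_chain P h /\ forall h', prime_chain P h' -> (h' <= h)%N.

(* The height of I is h: the minimum of the heights of the primes containing I.
   Primes of infinite height satisfy prime_chain Q h for every h. *)
Definition has_height I (h : nat) : Prop :=
  (exists P, [/\ is_prime P, I `<=` P & prime_height P h]) /\
  (forall Q, is_prime Q -> I `<=` Q -> prime_chain Q h).

Lemma has_height_inj I h1 h2 : has_height I h1 -> has_height I h2 -> h1 = h2.
Proof.
move=> [[P1 [p1 s1 [_ m1]]] l1] [[P2 [p2 s2 [_ m2]]] l2].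
by apply/eqP; rewrite eqn_leq (m2 _ (l1 _ p2 s2)) (m1 _ (l2 _ p1 s1)).
Qed.

End Height.

Section Borel.

Variable n : nat.
Implicit Types u : 'X_{1..n}.

Definition mnm_supp u : {set 'I_n} := [set i | u i != 0%N].

(* The variable x_(i.+1) has index i : 'I_n, hence the shift. On the monomial 1
   (written 0%MM), whose support is empty, the value is n. *)
Definition mnm_min u : nat := \big[minn/n]_(i in mnm_supp u) i.+1.

Lemma mnm_minE u (i : 'I_n) :
  i \in mnm_supp u -> (forall j, j \in mnm_supp u -> (i <= j)%N) ->
  mnm_min u = i.+1.
Proof.
move=> iu imin; apply/eqP; rewrite /mnm_min eqn_leq; apply/andP; split.
  have : i \in index_enum 'I_n by exact: mem_index_enum.
  elim: (index_enum _) => // j r IHr; rewrite inE big_cons => /predU1P[<-|ir].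
    by rewrite iu geq_minl.
  by case: ifP => _; rewrite ?geq_min IHr ?orbT.
elim/big_rec: _ => [|j x ju ix]; first exact: ltn_ord.
by rewrite leq_min ltnS imin.
Qed.

Definition k_bounded (k : nat) u : Prop := forall i, (u i <= k)%N.

(* The exponent of x_i (u / x_j), meaningful for j in the support of u. *)
Definition borel_move u (i j : 'I_n) : 'X_{1..n} := (U_(i) + (u - U_(j)))%MM.

Variable K : fieldType.
Implicit Types I : set {mpoly K[n]}.

Definition k_bounded_ideal (k : nat) I : Prop :=
  exists G : set 'X_{1..n},
    G `<=` k_bounded k /\ I = ideal_generated [set 'X_[K, u] | u in G].

Definition k_Borel (k : nat) I : Prop :=
  k_bounded_ideal k I /\
  forall u (i j : 'I_n),
    k_bounded k u -> I 'X_[u] -> j \in mnm_supp u -> (i < j)%N ->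
    k_bounded k (borel_move u i j) -> I 'X_[borel_move u i j].

Definition B (k m : nat) (u : 'I_m -> 'X_{1..n}) : set {mpoly K[n]} :=
  smallest (k_Borel k) [set 'X_[u s] | s in [set: 'I_m]].

End Borel.

Arguments B {n} K k {m} u.

(* Main.v *)
Require Import Defs.
From HB Require Import structures.
From mathcomp Require Import all_boot all_order all_algebra.
From mathcomp Require Import boolp classical_sets.
From mathcomp Require Import freeg mpoly.

(** Let h be the largest of the min(u_s), and let P_T denote the ideal generated
    by the variables with index in T. It is the kernel of the substitution of 0
    for these variables, hence a prime, and it contains a monomial if and only if
    some variable of T divides this monomial.

    Upper bound. The ideal P_T of the first h variables is k-Borel and contains
    every u_s, so it contains B ([varideal_k_Borel]). Its height is at most h
    ([prime_chain_varideal]): a chain of primes ending at P_T can be prolonged by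
    adjoining the n - h other variables one at a time, and no chain of primes of
    K[x_1, ..., x_n] has length greater than n ([prime_chain_dim]). For the latter,
    pick y_i in the i-th prime of the chain but not in the one before it. A
    nonzero polynomial expression in the y_i lies outside the smallest prime
    ([chain_alg_indep]), whereas more than n polynomials in n variables are
    algebraically dependent, by counting monomials ([mpoly_alg_dep]).

    Lower bound. Let Q be a prime containing B, let T be the set of the variables
    in Q, and let u_s be a generator with min(u_s) = h. If T had fewer than h
    elements, then among the first h - 1 variables there would be at least as many
    outside T as there are variables of T dividing u_s. Borel moves transfer the
    exponents of the latter to the former, one whole exponent at a time, which
    preserves k-boundedness ([B_avoid]). The result is a monomial of B, hence of
    Q, which no variable in Q divides; this is absurd since Q is prime
    ([prime_vars_ge]). So Q contains h variables, and the primes generated by the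
    first few of these form a chain of length h up to Q ([prime_chain_vars]). *)

Set Implicit Arguments.
Unset Strict Implicit.
Unset Printing Implicit Defensive.

Import GRing.Theory.

Local Open Scope classical_set_scope.
Local Open Scope ring_scope.

(** * Ideals and chains of primes *)

Section Ideals.

Variable R : comNzRingType.
Implicit Types (I P Q : set R) (x y : R).

Lemma ideal_opp I x : is_ideal I -> I x -> I (- x).
Proof. by case=> _ _ IM Ix; rewrite -mulN1r; apply: IM. Qed.

Lemma ideal_add_cancel I x y : is_ideal I -> I x -> I (x + y) -> I y.
Proof.
move=> idI Ix Ixy; have [_ ID _] := idI.
by rewrite -(addKr x y); apply: ID => //; apply: ideal_opp.
Qed.

Lemma prime_chain_rcons P Q h :
  prime_chain P h -> is_prime Q -> P `<` Q -> prime_chain Q h.+1.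
Proof.
case=> C [Cpr Clt Ch] Qpr PQ; exists (fun i => if (i <= h)%N then C i else Q).
split=> [i _|i|]; last by rewrite ltnn.
- by case: ifP => // /Cpr.
- rewrite ltnS => ih; rewrite ih; case: ifP => [/Clt //|ih'].
  by have -> : i = h; [apply/eqP; rewrite eqn_leq ih leqNgt ih' | rewrite Ch].
Qed.

(** A nonzero polynomial in an element t of P' \ P, whose nonzero coefficients
    avoid P', avoids P. *)
Lemma horner_notin_prime (A : nzRingType) (g : {rmorphism A -> R}) P P' t :
    is_prime P -> is_ideal P' -> P `<=` P' -> P' t -> ~ P t ->
    (forall a, a != 0 -> ~ P' (g a)) ->
  forall p : {poly A}, p != 0 -> ~ P (map_poly g p).[t].
Proof.
move=> [idP _ Ppr] idP' PP' P't Pt gN; elim/poly_ind => [|p c IHp].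
  by rewrite eqxx.
rewrite rmorphD rmorphM /= map_polyX map_polyC /= !hornerE.
have [->|c0] := eqVneq c 0; last first.
  move=> _ /PP' P'v; apply: (gN c) => //.
  by apply: (ideal_add_cancel idP' _ P'v); case: idP' => _ _; apply.
rewrite !rmorph0 !addr0 => pX0 Pvt; case: (Ppr _ _ Pvt) => //; apply: IHp.
by apply: contraNneq pX0 => ->; rewrite mul0r.
Qed.

End Ideals.

(** * Algebraic dependence and the dimension of a polynomial ring *)

(** The evaluation of p is that of its univariate form [muni p] in the last
    variable, whose coefficients are polynomials in the other variables. The
    evaluation of these coefficients is kept abstract, as a morphism g. *)
Lemma rmorph_mmap_muni (K R : comNzRingType) (f : {rmorphism K -> R}) l
    (y : 'I_l.+1 -> R) (g : {rmorphism {mpoly K[l]} -> R}) :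
    (forall c, g c%:MP = f c) ->
    (forall i, g 'X_i = y (widen_ord (leqnSn l) i)) ->
  forall p : {mpoly K[l.+1]}, mmap f y p = (map_poly g (muni p)).[y ord_max].
Proof.
move=> gC gX; elim/mpolyind => [|c m p _ _ IHp].
  by rewrite muni0 map_poly0 mmap0 horner0.
rewrite muniD mmapD (rmorphD (map_poly g)) hornerD; congr (_ + _); last exact: IHp.
rewrite muniZ mmapZ mmapX -mul_polyC.
rewrite rmorphM hornerM /= map_polyC hornerC /= gC; congr (_ * _).
rewrite /muni mmapX /mmap1 rmorph_prod horner_prod.
apply: eq_bigr => i _; rewrite rmorphXn horner_exp; congr (_ ^+ _).
case: splitP => [j ij|j ij].
  rewrite /= map_polyC hornerC /= gX; congr y; exact/val_inj.
rewrite /= map_polyX hornerX; congr y; apply/val_inj => /=.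
by move: ij => /= ->; rewrite ord1 addn0.
Qed.

Lemma mmap_muni (K R : comNzRingType) (f : {rmorphism K -> R}) l
    (y : 'I_l.+1 -> R) (p : {mpoly K[l.+1]}) :
  mmap f y p =
  (map_poly (mmap f (fun i : 'I_l => y (widen_ord (leqnSn l) i)))
     (muni p)).[y ord_max].
Proof.
by apply: rmorph_mmap_muni => [c|i] /=; rewrite ?mmapC ?mmapX ?mmap1U.
Qed.

Lemma muni_eq0 (K : comNzRingType) l (p : {mpoly K[l.+1]}) :
  (muni p == 0) = (p == 0).
Proof.
apply/eqP/eqP => [p0|->]; last exact: muni0.
(* The substitution of each variable for itself is an evaluation. *)
rewrite -[p]comp_mpoly_id /comp_mpoly mmap_muni.
by rewrite p0 raddf0 horner0.
Qed.

(** If y_i lies in C_(l - i) but not in C_(l - i - 1), for a chain of primes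
    C_0, ..., C_l of a K-algebra, then y_0, ..., y_(l - 1) are algebraically
    independent over K, even modulo C_0. *)
Lemma chain_alg_indep (K : fieldType) (R : comNzRingType)
    (f : {rmorphism K -> R}) l (C : nat -> set R) (y : 'I_l -> R) :
    (forall i, (i <= l)%N -> is_prime (C i)) ->
    (forall i, (i < l)%N -> C i `<=` C i.+1) ->
    (forall i : 'I_l, C (l - i)%N (y i)) ->
    (forall i : 'I_l, ~ C (l - i.+1)%N (y i)) ->
  forall Q : {mpoly K[l]}, Q != 0 -> ~ C 0%N (mmap f y Q).
Proof.
elim: l C y => [|l IHl] C y Cpr CS Cy CNy Q Q0.
  have [[_ _ CM] C1 _] := Cpr 0%N isT.
  have Qc : Q = (Q@_0%MM)%:MP.
    apply/mpolyP => m; rewrite mcoeffC.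
    have -> : m = 0%MM by apply/mnmP; case.
    by rewrite eqxx mulr1.
  have c0 : Q@_0%MM != 0 by apply: contraNneq Q0 => c0; rewrite Qc c0.
  rewrite Qc mmapC => Cc; apply: C1; rewrite -(rmorph1 f) -(mulVf c0) rmorphM.
  exact: CM.
rewrite mmap_muni; apply: (@horner_notin_prime _ _ _ _ (C 1%N)).
- exact: Cpr.
- by case: (Cpr 1%N isT).
- exact: CS.
- by have := Cy ord_max; rewrite /= subSnn.
- by have := CNy ord_max; rewrite /= subnn.
- apply: (IHl (fun i => C i.+1)) => [i il|i il|i|i].
  + exact: Cpr.
  + exact: CS.
  + by have := Cy (widen_ord (leqnSn l) i); rewrite /= subSn // ltnW.
  + by have := CNy (widen_ord (leqnSn l) i); rewrite /= subSS -subnSK.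
- by rewrite muni_eq0.
Qed.

Section Dependence.

Variables (K : fieldType) (n : nat).
Implicit Types p q : {mpoly K[n]}.

(** In a polynomial of [msize] at most M, all exponents are less than M: at most
    M ^ n monomials occur. *)
Lemma mpoly_lin_dep (I : finType) (p : I -> {mpoly K[n]}) M :
    (forall i, (msize (p i) <= M)%N) -> (M ^ n < #|I|)%N ->
  exists2 c : I -> K, exists i, c i != 0 & \sum_i c i *: p i = 0.
Proof.
move=> pM MI; pose J := {ffun 'I_n -> 'I_M}.
have cJ : #|{: J}| = (M ^ n)%N by rewrite card_ffun !card_ord.
(* The coefficients of the p i; a nonzero row of the kernel is a relation. *)
pose A := \matrix_(i < #|I|, j < #|{: J}|)
  (p (enum_val i))@_[multinom (enum_val j k : nat) | k < n].
have kA : kermx A != 0.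
  rewrite kermx_eq0 /row_free neq_ltn (leq_ltn_trans (rank_leq_col A)) //.
  by rewrite cJ.
have [r rA] : exists r, row r (kermx A) != 0.
  apply/existsP; apply: contraNT kA => /existsPn z; apply/eqP/row_matrixP => r.
  by rewrite row0; apply/eqP/negbNE.
set v := row r _ in rA.
have vA : v *m A = 0 by rewrite -row_mul mulmx_ker row0.
exists (fun i => v 0 (enum_rank i)).
  have /rV0Pn[j vj] := rA.
  by exists (enum_val j); rewrite enum_valK.
apply/mpolyP => m; rewrite raddf_sum mcoeff0 /=.
have [mM|] := boolP [forall k, (m k < M)%N]; last first.
  move=> /forallPn[k]; rewrite -leqNgt => Mk; apply: big1 => i _.
  rewrite mcoeffZ memN_msupp_eq0 ?mulr0 //; apply: msize_mdeg_ge.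
  by rewrite (leq_trans (pM i)) // (leq_trans Mk) // mdegE (bigD1 k) //= leq_addr.
pose j : J := [ffun k => Ordinal (forallP mM k)].
have jm : m = [multinom (j k : nat) | k < n].
  by apply/mnmP => k; rewrite mnmE ffunE.
have /matrixP/(_ 0 (enum_rank j)) := vA; rewrite mxE [RHS]mxE => vAj.
rewrite -[RHS]vAj (reindex (@enum_val I predT)) /=; last exact/onW_bij/enum_val_bij.
by apply: eq_bigr => i _; rewrite mcoeffZ [A _ _]mxE enum_valK enum_rankK -jm.
Qed.

(** Since [msize] is one more than the degree, this is the subadditivity of the
    degree, stated so as to hold for 0 as well. *)
Lemma msizeM_leS p q d e :
  (msize p <= d.+1 -> msize q <= e.+1 -> msize (p * q) <= (d + e).+1)%N.
Proof.
have [->|p0] := eqVneq p 0; first by rewrite mul0r msize0.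
have [->|q0] := eqVneq q 0; first by rewrite mulr0 msize0.
move=> pd qe; rewrite msizeM //; case: (msize p) pd => [_|s sd].
  by rewrite add0n (leq_trans (leq_pred _)) // (leq_trans qe) // ltnS leq_addl.
by rewrite addSn /= -addnS leq_add.
Qed.

Lemma msize_mmap1_le l (y : 'I_l -> {mpoly K[n]}) (a : 'X_{1..l}) d :
  (forall i, msize (y i) <= d.+1)%N -> (msize (mmap1 y a) <= (mdeg a * d).+1)%N.
Proof.
move=> yd; rewrite /mmap1 mdegE big_distrl /=.
elim/big_ind2: _ => [|s p t q|i _]; first by rewrite msize1.
  exact: msizeM_leS.
elim: (a i) => [|k IHk]; first by rewrite expr0 msize1.
by rewrite exprS mulSn; apply: msizeM_leS.
Qed.

(** More than n polynomials in n variables are algebraically dependent: for N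
    large, there are more monomials of exponents less than N in them than
    monomials in the variables which these can involve. *)
Lemma mpoly_alg_dep l (y : 'I_l -> {mpoly K[n]}) :
  (n < l)%N -> exists2 Q : {mpoly K[l]}, Q != 0 & mmap (@mpolyC n K) y Q = 0.
Proof.
move=> nl; pose d := \max_i msize (y i); pose N := ((l * d).+1 ^ n).+1.
have yd i : (msize (y i) <= d.+1)%N.
  by apply: leqW; apply: (leq_bigmax (F := fun i => msize (y i))).
pose mon (a : {ffun 'I_l -> 'I_N}) := [multinom (a i : nat) | i < l].
have mon_inj : injective mon.
  move=> a b /mnmP ab; apply/ffunP => i; apply/val_inj.
  by have := ab i; rewrite !mnmE.
have size_mon a : (msize (mmap1 y (mon a)) <= N * (l * d).+1)%N.
  apply: (leq_trans (msize_mmap1_le _ yd)).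
  rewrite mulnS -addn1 addnC leq_add //.
  rewrite mulnC [(l * d)%N]mulnC mulnCA leq_mul2l; apply/orP; right.
  rewrite mdegE (@leq_trans (\sum_(i < l) N)%N) //; last first.
    by rewrite sum_nat_const card_ord mulnC.
  by apply: leq_sum => i _; rewrite mnmE ltnW.
have N1 : (1 < N)%N by rewrite ltnS expn_gt0.
have [|c [a ca] cy0] := mpoly_lin_dep size_mon.
  rewrite card_ffun !card_ord expnMn (@leq_trans (N ^ n.+1)%N) ?leq_exp2l //.
  by rewrite expnSr ltn_pmul2l // expn_gt0.
exists (\sum_b c b *: 'X_[mon b]).
  apply: contra ca => /eqP/(congr1 (mcoeff (mon a))).
  rewrite raddf_sum mcoeff0 (bigD1 a) //= big1 => [|b ba].
    by rewrite mcoeffZ mcoeffX eqxx mulr1 addr0 => ->.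
  by rewrite mcoeffZ mcoeffX (inj_eq mon_inj) (negPf ba) mulr0.
rewrite raddf_sum -[RHS]cy0; apply: eq_bigr => b _.
by rewrite /= mmapZ mmapX mul_mpolyC.
Qed.

(** The Krull dimension of a polynomial ring in n variables is at most n. *)
Lemma prime_chain_dim (P : set {mpoly K[n]}) h : prime_chain P h -> (h <= n)%N.
Proof.
case=> C [Cpr Clt _]; rewrite leqNgt; apply/negP => nh.
have /choice[y yP] : forall i : 'I_h, exists y : {mpoly K[n]},
    C (h - i)%N y /\ ~ C (h - i.+1)%N y.
  move=> i; have [|_] := Clt (h - i.+1)%N.
    by rewrite ltn_subrL (leq_ltn_trans _ (ltn_ord i)).
  rewrite subnSK // => /existsNP[y /not_implyP yP]; by exists y.
have [Q Q0 Qy] := mpoly_alg_dep y nh.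
have CS i : (i < h)%N -> C i `<=` C i.+1 by move=> /Clt[].
have : C 0%N (mmap (@mpolyC n K) y Q) by rewrite Qy; case: (Cpr 0%N isT) => [[]].
exact: (chain_alg_indep Cpr CS (fun i => (yP i).1) (fun i => (yP i).2) Q0).
Qed.

End Dependence.

(** * Primes generated by variables *)

Section VariablePrimes.

Variables (K : fieldType) (n : nat).
Implicit Types (T : {set 'I_n}) (p q : {mpoly K[n]}) (I Q : set {mpoly K[n]}).

(** The substitution of 0 for the variables of T. *)
Definition kill T : {mpoly K[n]} -> {mpoly K[n]} :=
  mmap (@mpolyC n K) (fun i => if i \in T then 0 else 'X_i).

HB.instance Definition _ T := GRing.RMorphism.on (kill T).

(** The ideal generated by the variables of T, as the kernel of [kill T]. *)
Definition varideal T : set {mpoly K[n]} := [set p | kill T p = 0].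

Lemma killX T m :
  kill T 'X_[m] = \prod_i (if i \in T then 0 else 'X_i) ^+ m i.
Proof. exact: mmapX. Qed.

Lemma kill_var T i : kill T 'X_i = if i \in T then 0 else 'X_i.
Proof. by rewrite /kill mmapX mmap1U. Qed.

Lemma varidealX T m : varideal T 'X_[m] <-> exists2 i, i \in T & m i != 0%N.
Proof.
rewrite /varideal /= killX; split=> [/eqP/prodf_eq0[i _]|[i iT mi]].
  rewrite expf_eq0 lt0n => /andP[mi]; case: ifP => [iT _|_]; first by exists i.
  by rewrite -msupp_eq0 msuppX.
by apply/eqP/prodf_eq0; exists i => //; rewrite iT expr0n (negPf mi).
Qed.

Lemma varideal_var T i : varideal T 'X_i <-> i \in T.
Proof.
rewrite varidealX; split=> [[j jT]|iT]; last by exists i; rewrite // mnm1E eqxx.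
by rewrite mnm1E eqb0 negbK => /eqP->.
Qed.

Lemma varideal_prime T : is_prime (varideal T).
Proof.
split=> [||p q]; rewrite /varideal /=.
- split=> [|p q|p q] /=; first exact: rmorph0.
    by move=> p0 q0; rewrite rmorphD /= p0 q0 addr0.
  by move=> q0; rewrite rmorphM /= q0 mulr0.
- by rewrite rmorph1; apply/eqP/oner_neq0.
- by rewrite rmorphM => /eqP; rewrite mulf_eq0 => /orP[]/eqP; [left|right].
Qed.

Lemma varideal_min T I :
  is_ideal I -> (forall i, i \in T -> I 'X_i) -> varideal T `<=` I.
Proof.
move=> idI IT; have [I0 ID IM] := idI.
(* The substitution is the identity modulo I. *)
have IX m : I ('X_[m] - kill T 'X_[m]).
  rewrite mpolyXE_id rmorph_prod.
  elim/big_ind2: _ => [|p p' q q' Ip Iq|i _].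
  - by rewrite subrr.
  - have -> : p * q - p' * q' = p * (q - q') + q' * (p - p').
      by rewrite !mulrBr addrA [q' * p]mulrC [q' * p']mulrC subrK.
    by apply: ID; apply: IM.
  - rewrite rmorphXn /= kill_var; case: ifP => [iT|_]; last by rewrite subrr.
    case: (m i) => [|k]; first by rewrite subrr.
    by rewrite expr0n subr0 exprSr; apply: IM; apply: IT.
move=> p; rewrite /varideal /= => p0.
have -> : p = \sum_(m <- msupp p) (p@_m)%:MP * ('X_[m] - kill T 'X_[m]).
  have pE : p = \sum_(m <- msupp p) (p@_m)%:MP * 'X_[m].
    by rewrite {1}(mpolyE p); apply: eq_bigr => m _; rewrite mul_mpolyC.
  have kE : kill T p = \sum_(m <- msupp p) (p@_m)%:MP * kill T 'X_[m].
    by apply: eq_bigr => m _; rewrite killX.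
  rewrite -[LHS]subr0 -[X in _ - X]p0 kE {1}pE -sumrB.
  by apply: eq_bigr => m _; rewrite mulrBr.
by elim/big_ind: _ => // m _; apply: IM.
Qed.

Lemma varideal_gen T :
  varideal T = ideal_generated [set 'X_[K, u] | u in [set U_(i)%MM | i in [set` T]]].
Proof.
apply/seteqP; split.
  apply: varideal_min => [|i iT].
    split=> [I [[]] //|p q Ip Iq I GI|p q Iq I GI]; have [[_ ID IM] _] := GI.
      by apply: ID; [apply: Ip|apply: Iq].
    by apply: IM; apply: Iq.
  by move=> I [_]; apply; exists U_(i)%MM => //; exists i.
apply: smallest_sub; first by case: (varideal_prime T).
by move=> _ [_ [i iT <-] <-]; apply/varideal_var.
Qed.

(** The height of [varideal T] is at most #|T|: adjoining the other variables one
    at a time prolongs a chain, and the dimension bounds its length. *)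
Lemma prime_chain_varideal T h : prime_chain (varideal T) h -> (h <= #|T|)%N.
Proof.
have [k] := ubnP #|~: T|; elim: k T h => // k IHk T h kT Th.
have [T0|[i]] := set_0Vmem (~: T).
  rewrite -[T]finset.setCK T0 finset.setC0 cardsT card_ord; exact: prime_chain_dim Th.
rewrite inE => iT.
have ciT : #|i |: T| = #|T|.+1 by rewrite cardsU1 iT.
rewrite -ltnS -ciT; apply: IHk.
  have cT := cardsC T; have ciTC := cardsC (i |: T).
  by rewrite -(ltn_add2l #|i |: T|) ciTC -cT ciT addSnnS ltn_add2l ltnS -ltnS.
apply: prime_chain_rcons Th (varideal_prime _) _; split.
  apply: varideal_min => [|j jT]; first by case: (varideal_prime (i |: T)).
  by apply/varideal_var; rewrite !inE jT orbT.
move=> /(_ 'X_i) sub; move/negP: iT; apply; apply/varideal_var; apply: sub.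
by apply/varideal_var; rewrite !inE eqxx.
Qed.

(** A prime containing h variables x_t has height at least h, by the chain of
    the primes generated by the first j of these variables, for j < h. *)
Lemma prime_chain_vars Q T h :
    is_prime Q -> (forall i, i \in T -> Q 'X_i) -> (h <= #|T|)%N ->
  prime_chain Q h.
Proof.
move=> Qpr QT hT; pose t := enum T.
pose C j := if (j < h)%N then varideal [set i in take j t] else Q.
have Cpr j : is_prime (C j).
  by rewrite /C; case: ifP => _ //; apply: varideal_prime.
exists C; split=> [//|j jh|]; last by rewrite /C ltnn.
have CX i : i \in take j.+1 t -> C j.+1 'X_i.
  rewrite /C => it; case: ifP => _.
    by apply/varideal_var; rewrite inE.
  by apply: QT; have /mem_take := it; rewrite mem_enum.
have -> : C j = varideal [set i in take j t] by rewrite /C jh.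
have jt : (j < size t)%N by rewrite -cardE (leq_trans jh).
have [i0 _] : exists i, i \in T.
  by apply/card_gt0P; rewrite (leq_trans _ hT) // (leq_ltn_trans _ jh).
rewrite (take_nth i0 jt) in CX; split.
  apply: varideal_min => [|i]; first by case: (Cpr j.+1).
  by rewrite inE => it; apply: CX; rewrite mem_rcons inE it orbT.
have jnth : ~ varideal [set i in take j t] 'X_(nth i0 t j).
  move/varideal_var; rewrite inE; apply/negP.
  have := take_uniq j.+1 (enum_uniq T).
  by rewrite (take_nth i0 jt) rcons_uniq => /andP[].
by move=> sub; apply: jnth; apply: sub; apply: CX; rewrite mem_rcons mem_head.
Qed.

End VariablePrimes.

(** * Borel ideals *)

Section BorelIdeals.

Variables (n k : nat).
Implicit Types (u v : 'X_{1..n}) (i j l : 'I_n) (T : {set 'I_n}).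

Lemma mnm_min_attained u : u != 0%MM ->
  exists i, [/\ u i != 0%N, mnm_min u = i.+1 & forall j, u j != 0%N -> (i <= j)%N].
Proof.
move=> u0; have [i0 ui0] : exists i, u i != 0%N.
  apply/existsP; apply: contraNT u0 => /existsPn u0; apply/eqP/mnmP => i.
  by rewrite mnm0E; apply/eqP/negbNE.
case: (@arg_minnP _ i0 (fun i => u i != 0%N) val ui0) => i ui imin.
by exists i; split=> //; apply: mnm_minE => [|j]; rewrite inE //; apply: imin.
Qed.

(** The initial segment of the h first variables. *)
Definition first_vars h : {set 'I_n} := [set i : 'I_n | (i < h)%N].

Lemma card_first_vars h : (h <= n)%N -> #|first_vars h| = h.
Proof.
move=> hn; have inj : injective (widen_ord hn).
  by move=> i j /(congr1 val) ij; apply/val_inj.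
rewrite -[RHS]card_ord -(card_imset _ inj); apply: eq_card => i.
rewrite inE; apply/idP/imsetP => [ih|[j _ ->]]; last exact: (ltn_ord j).
by exists (Ordinal ih) => //; apply/val_inj.
Qed.

Variable K : fieldType.

Lemma varideal_k_Borel h : (0 < k)%N -> k_Borel k (@varideal K n (first_vars h)).
Proof.
move=> k0; split.
  exists [set U_(i)%MM | i in [set` first_vars h]]; split; last exact: varideal_gen.
  by move=> _ [i _ <-] l; rewrite mnm1E (leq_trans (leq_b1 _)).
move=> u i j _ /varidealX[l lh ul] _ ij _; apply/varidealX.
have [jl|jl] := eqVneq j l.
  exists i; last by rewrite mnmDE mnm1E eqxx.
  by move: lh; rewrite !inE -jl; apply: ltn_trans.
exists l => //; rewrite mnmDE mnmBE [(U_(j)%MM l)]mnm1E (negPf jl) subn0.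
by rewrite addn_eq0 negb_and ul orbT.
Qed.

Lemma prime_monomial (Q : set {mpoly K[n]}) v :
  is_prime Q -> Q 'X_[v] -> exists2 i, v i != 0%N & Q 'X_i.
Proof.
move=> [_ Q1 QM]; rewrite mpolyXE_id => Qv; apply: contrapT => Qi; move: Qv.
apply: (big_ind (fun p => ~ Q p)) => // [p q Np Nq /QM[]//|i _].
have : v i != 0%N -> ~ Q 'X_i by move=> vi Qx; apply: Qi; exists i.
elim: (v i) => [|d IHd] Nx; first by rewrite expr0.
rewrite exprS => /QM[|]; first exact: Nx.
by case: d IHd Nx => [|d] IHd Nx; [rewrite expr0 | apply: IHd => _; apply: Nx].
Qed.

Variables (m : nat) (u : 'I_m -> 'X_{1..n}).

Lemma B_gen s : B K k u 'X_[u s].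
Proof. by move=> I [_]; apply; exists s. Qed.

Lemma B_move v i j :
    k_bounded k v -> B K k u 'X_[v] -> v j != 0%N -> (i < j)%N ->
    k_bounded k (borel_move v i j) ->
  B K k u 'X_[borel_move v i j].
Proof.
move=> vk Bv vj ij mk I BI; have [[_ IB] _] := BI.
by apply: IB => //; [exact: (Bv I BI) | rewrite inE].
Qed.

(** The transfer of the full exponent of x_j to x_i, which is meant for v i = 0:
    the former exponent of x_i is lost. *)
Definition transfer v i j : 'X_{1..n} :=
  [multinom (if l == i then v j else if l == j then 0 else v l)%N | l < n].

Lemma transfer_bounded v i j : k_bounded k v -> k_bounded k (transfer v i j).
Proof. by move=> vk l; rewrite mnmE; do 2?case: ifP => _. Qed.

Lemma B_transfer v i j :
    k_bounded k v -> B K k u 'X_[v] -> (i < j)%N -> v i = 0%N ->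
  B K k u 'X_[transfer v i j].
Proof.
move=> vk Bv ij vi.
(* The monomial reached from v after a moves. *)
pose w a : 'X_{1..n} :=
  [multinom (if l == i then a else if l == j then v j - a else v l)%N | l < n].
have ji : (j == i) = false by apply/negP => /eqP ji; rewrite ji ltnn in ij.
have wk a : (a <= v j)%N -> k_bounded k (w a).
  move=> av l; rewrite mnmE; case: ifP => _; first exact: leq_trans av _.
  by case: ifP => _; rewrite ?leq_subLR ?(leq_trans (vk _)) ?leq_addl.
have wS a : (a < v j)%N -> borel_move (w a) i j = w a.+1.
  move=> av; apply/mnmP => l; rewrite mnmDE mnmBE !mnm1E !mnmE.
  rewrite [i == l]eq_sym [j == l]eq_sym.
  case: eqP => [->|_]; first by rewrite eq_sym ji subn0.
  by case: eqP => _; rewrite ?subn0 // add0n subnS subn1.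
have Bw a : (a <= v j)%N -> B K k u 'X_[w a].
  elim: a => [_|a IHa av].
    have -> // : w 0%N = v.
    by apply/mnmP => l; rewrite mnmE subn0; do 2?case: eqP => [->|_].
  rewrite -wS //; apply: B_move => //; [exact: wk (ltnW av)|exact: IHa (ltnW av)| |].
    by rewrite mnmE ji eqxx subn_eq0 -ltnNge.
  by rewrite wS //; apply: wk.
have -> : transfer v i j = w (v j); last exact: Bw.
by apply/mnmP => l; rewrite !mnmE subnn.
Qed.

(** If the indices of T at which v has a nonzero exponent are all at least i0, and
    if there are at least as many indices below i0, outside T, at which v has
    exponent 0, then transfers from the former to the latter yield a monomial of B
    which no variable of T divides. *)
Lemma B_avoid T i0 v :
    k_bounded k v -> B K k u 'X_[v] ->
    (forall j, j \in T -> v j != 0%N -> (i0 <= j)%N) ->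
    (#|[set j in T | v j != 0%N]| <=
     #|[set i | (i \notin T) && (i < i0)%N && (v i == 0%N)]%SET|)%N ->
  exists2 w, B K k u 'X_[w] & forall j, j \in T -> w j = 0%N.
Proof.
have [d] := ubnP #|[set j in T | v j != 0%N]|; elim: d v => // d IHd v.
set D := [set j in T | _]; set E := [set i | _]%SET => Dd vk Bv Ti0 DE.
have [D0|[j jD]] := set_0Vmem D.
  exists v => // j jT; apply/eqP/negbNE/negP => vj.
  by have : j \in D; [rewrite inE jT | rewrite D0 inE].
have [i iE] : exists i, i \in E.
  by apply/card_gt0P; apply: leq_trans DE; apply/card_gt0P; exists j.
have := jD; have := iE; rewrite !inE => /andP[/andP[iT ii0] /eqP vi] /andP[jT vj].
have ij : (i < j)%N by apply: leq_trans ii0 (Ti0 j jT vj).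
have D' : [set l in T | transfer v i j l != 0%N] = D :\ j.
  apply/setP => l; rewrite !inE mnmE.
  case: (l =P i) => [->|_]; first by rewrite (negPf iT) andbF.
  by case: (l =P j) => _; rewrite ?andbF.
have E' :
    [set l | (l \notin T) && (l < i0)%N && (transfer v i j l == 0%N)]%SET = E :\ i.
  apply/setP => l; rewrite !inE mnmE.
  case: (l =P i) => [->|_]; first by rewrite (negPf vj) andbF.
  by case: (l =P j) => [->|_] //; rewrite jT.
have cD : #|D| = (1 + #|D :\ j|)%N by rewrite (cardsD1 j) jD.
have cE : #|E| = (1 + #|E :\ i|)%N by rewrite (cardsD1 i) iE.
apply: (IHd (transfer v i j)).
- by move: Dd; rewrite D' cD add1n ltnS.
- exact: transfer_bounded.
- exact: B_transfer.
- move=> l lT; rewrite mnmE; case: (l =P i) => [li|_]; first by rewrite -li lT in iT.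
  by case: (l =P j) => // _; apply: Ti0.
- by rewrite D' E' -(leq_add2l 1%N) -cD -cE.
Qed.

(** A prime containing B contains at least min (u_s) variables. *)
Lemma prime_vars_ge (Q : set {mpoly K[n]}) s :
    k_bounded k (u s) -> u s != 0%MM -> is_prime Q -> B K k u `<=` Q ->
  (mnm_min (u s) <= #|[set i | `[<Q 'X_i>]]%SET|)%N.
Proof.
move=> uk /mnm_min_attained[i0 [_ -> imin]] Qpr BQ; set T := [set i | _]%SET.
rewrite leqNgt ltnS; apply/negP => Ti0.
have [j jT /imin //||w Bw wT] := @B_avoid T i0 (u s) uk (B_gen s).
  (* F is the set of the variables before x_i0, none of which divides u s. *)
  set F := first_vars i0; have cF : #|F| = i0 by rewrite card_first_vars // ltnW.
  apply: (@leq_trans #|T :\: F|).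
    apply: subset_leq_card; apply/fintype.subsetP => j; rewrite !inE => /andP[-> uj].
    by rewrite -leqNgt imin.
  apply: (@leq_trans #|F :\: T|).
    by rewrite -(leq_add2l #|T :&: F|) cardsID finset.setIC cardsID cF.
  apply: subset_leq_card; apply/fintype.subsetP => j; rewrite !inE => /andP[-> ji0].
  by rewrite ji0 /=; apply: contraTT ji0 => /imin; rewrite -leqNgt.
have [i wi Qi] := prime_monomial Qpr (BQ _ Bw).
by move: wi; rewrite wT // inE; apply/asboolP.
Qed.

End BorelIdeals.

Theorem proposition1p6 (K : fieldType) (n k m : nat) (u : 'I_m -> 'X_{1..n})
    (hk : (1 <= k)%N) (hm : (1 <= m)%N)
    (hu : forall s : 'I_m, k_bounded k (u s))
    (hu1 : forall s : 'I_m, u s != 0%MM) :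
  has_height (B K k u) (\max_(s < m) mnm_min (u s)).
Proof.
have [|s0 hs0] := @eq_bigmax _ (fun s => mnm_min (u s)); first by rewrite card_ord.
set h := \max_(s < m) _.
have hn : (h <= n)%N.
  by rewrite /h hs0; have [i [_ -> _]] := mnm_min_attained (hu1 s0).
have Ph := @varideal_prime K n (first_vars n h).
split=> [|Q Qpr BQ]; last first.
  apply: (@prime_chain_vars K n _ [set i | `[<Q 'X_i>]]%SET) => // [i|].
    by rewrite inE => /asboolP.
  by rewrite /h hs0; apply: prime_vars_ge BQ.
exists (@varideal K n (first_vars n h)); split=> //.
  apply: smallest_sub; first exact: varideal_k_Borel.
  move=> _ [s _ <-]; apply/varidealX.
  have [i [ui mi _]] := mnm_min_attained (hu1 s); exists i => //.
  by rewrite inE -mi; apply: (leq_bigmax (F := fun s => mnm_min (u s))).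
split=> [|h' Ph']; last first.
  by rewrite -(card_first_vars hn); apply: prime_chain_varideal Ph'.
apply: (@prime_chain_vars K n _ (first_vars n h)) => // [i|].
  by move/varideal_var.
by rewrite card_first_vars.
Qed.
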